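(* Consider the hide-and-seek game described in the context with linking budget $b=n-1$ (so that the hider can only choose trees on $V$). Let $$D^{\star}=\arg\max_{d\in\{1,\ldots,n-1\}} A(d)\left(\frac{n+d-1}{2}\right).$$ Let $d^\star\in D^\star$, let $\eta$ be a mixed hiding in a crown of a palm tree of height $d^{\star}$, and let $\sigma$ be the randomized DFS seeking strategy. Then: (1) $(\eta,\sigma)$ is a (mixed strategy) Nash equilibrium of the game. (2) All Nash equilibria of the game yield the same payoff to the hider, and $\eta$ guarantees this equilibrium payoff to the hider against any (mixed) strategy of the seeker. (3) $\sigma$ is a best response to any equilibrium strategy of the hider, i.e. to every $\eta'$ such that $(\eta',\sigma')$ is a Nash equilibrium for some $\sigma'$. (4) The equilibrium payoff to the seeker is unique (i.e. the same in all Nash equilibria) if and only if $|D^{\star}|=1$.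
   Context: Graphs. All graphs are finite, simple and undirected. $V=\{s,v_1,\ldots,v_{n-1}\}$ is a set of $n\ge 2$ nodes with a distinguished source node $s$. $\mathcal{G}(V)$ is the set of connected graphs with node set $V$; $\mathcal{G}=\bigcup_{X\subseteq V}\mathcal{G}(X)$. $d_G(u,v)$ is the length (number of links) of a shortest path from $u$ to $v$ in $G$. $N_G(v)$ is the set of neighbours of $v$; for a set $X$ of nodes, $N_G(X)=\bigcup_{v\in X}N_G(v)\setminus X$. The closed subgraph $\overline{G}[X]$ induced by $X$ has node set $X\cup N_G(X)$ and its links are all links of $G$ with at least one endpoint in $X$. A finite sequence of nodes is also used to denote the set of its entries. Game. There are two players, the hider and the seeker, moving simultaneously. Given a budget $b$, a pure strategy of the hider is a pair $(G,h)$ with $G\in\mathcal{G}(V)$ having at most $b$ links and $h\in V$ (the hiding node). Let $\mathcal{I}$ be the set of pairs $(\boldsymbol{z},G')$, where $\boldsymbol{z}=(z_0,\ldots,z_{k-1})$ is a finite sequence of nodes of $V$ with $1\le k<n$, $z_0=s$, $G'\in\mathcal{G}$, $z_j\in N_{G'}(\{z_0,\ldots,z_{j-1}\})$ for all $j\in\{1,\ldots,k-1\}$, $G'=\overline{G'}[\boldsymbol{z}]$, and $N_{G'}(\boldsymbol z)\neq\varnothing$. A pure seeking strategy is a function $r:\mathcal{I}\to V$ with $r(\boldsymbol{z},G')\in N_{G'}(\boldsymbol{z})$ for all $(\boldsymbol{z},G')\in\mathcal{I}$; $R$ is the set of all of these. Given $G\in\mathcal{G}(V)$ and $r\in R$,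 the seeking sequence $\mathrm{seq}(G,r)=(v_0,\ldots,v_{n-1})$ is defined by $v_0=s$ and $v_i=r((v_0,\ldots,v_{i-1}),\overline{G}[\{v_0,\ldots,v_{i-1}\}])$ for $i\ge 1$. Let $\mathrm{pos}(h,\mathrm{seq}(G,r))$ be the index $i$ with $v_i=h$, i.e. the number of steps from the source to $h$ (so $s$ has position $0$). Payoffs. The benefit of the hider is $\Phi(G,h)=A(d_G(s,h))>0$, where $A$ is a non-increasing function (positive at all distances $0,\ldots,n-1$). The payoff of the seeker is $\pi^{\mathsf S}(G,h,r)=-\mathrm{pos}(h,\mathrm{seq}(G,r))$ and the payoff of the hider is $\pi^{\mathsf H}(G,h,r)=\mathrm{pos}(h,\mathrm{seq}(G,r))\,\Phi(G,h)$. Mixed strategies are probability distributions on pure strategies, and payoffs are extended to mixed strategy profiles by expectation. Randomized strategies. A map $\sigma$ assigning to each $(\boldsymbol z,G')\in\mathcal{I}$ a probability distribution on $N_{G'}(\boldsymbol z)$ is identified with the mixed seeking strategy that draws the values $r(\boldsymbol z,G')$ independently from $\sigma(\boldsymbol z,G')$. The randomized DFS is defined as follows: given $(\boldsymbol{z},G')\in\mathcal{I}$ with $\boldsymbol z=(z_0,\ldots,z_k)$, the active node is $z_j$ with $j=\max\{i\in\{0,\ldots,k\}: N_{G'}(z_i)\setminus\boldsymbol{z}\neq\varnothing\}$ (the most recently visited node with an unvisited neighbour), and the next node is chosen uniformly at random from $N_{G'}(z_j)\setminus\boldsymbol{z}$. Palm trees. For $d\in\{1,\ldots,n-1\}$,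 a palm tree of height $d$ is a graph on $V$ for which there is an ordering $v_0,\ldots,v_{n-1}$ of $V$ with $v_0=s$ and link set $\{v_0v_1,\ldots,v_{d-2}v_{d-1}\}\cup\{v_{d-1}v_d,\ldots,v_{d-1}v_{n-1}\}$. Its crown is $\{v_d,\ldots,v_{n-1}\}$. A mixed hiding in a crown of a palm tree of height $d$ is the mixed strategy of the hider that chooses a palm tree of height $d$ and picks the hiding node uniformly at random from its crown. *)

(* Defs.v *)
From HB Require Import structures.
From mathcomp Require Import all_boot all_order all_algebra.

Set Implicit Arguments.
Unset Strict Implicit.
Unset Printing Implicit Defensive.

Import Order.TTheory GRing.Theory Num.Theory.

Local Open Scope ring_scope.

(* A graph whose node set is contained in [V] is encoded by its node set and its
   set of links, a link being a two-element set of nodes. *)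

Definition graph_axiom (V : finType) (G : {set V} * {set {set V}}) : bool :=
  [forall e in G.2, (e \subset G.1) && (#|e| == 2)].

Record graph (V : finType) :=
  Graph { graph_val : {set V} * {set {set V}}; _ : graph_axiom graph_val }.

HB.instance Definition _ (V : finType) := [isSub for @graph_val V].
HB.instance Definition _ (V : finType) := [Finite of graph V by <:].

Definition nodes (V : finType) (G : graph V) : {set V} := (graph_val G).1.
Definition links (V : finType) (G : graph V) : {set {set V}} := (graph_val G).2.

Definition adj (V : finType) (G : graph V) : rel V :=
  fun u v => [set u; v] \in links G.

Definition connected_on (V : finType) (G : graph V) (X : {set V}) : bool :=
  (nodes G == X) && [forall u in X, forall v in X, connect (adj G) u v].

(* The value is the junk [#|V|] when there is no path from [u] to [v]. *)
Definition dist (V : finType) (G : graph V) (u v : V) : nat :=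
  \big[minn/#|V|]_(k < #|V| |
     [exists p : k.-tuple V, path (adj G) u p && (last u p == v)]) k.

Definition nbr (V : finType) (G : graph V) (v : V) : {set V} :=
  [set w | adj G v w].

Definition nbrs (V : finType) (G : graph V) (X : {set V}) : {set V} :=
  (\bigcup_(v in X) nbr G v) :\: X.

Lemma closed_subgraph_axiom (V : finType) (G : graph V) (X : {set V}) :
  graph_axiom (X :|: nbrs G X, [set e in links G | e :&: X != set0]).
Proof.
apply/forall_inP => e /=; rewrite inE => /andP[eG /set0Pn[x]].
rewrite inE => /andP[xe xX].
have /forall_inP/(_ e eG)/andP[_ /[dup] e2 ->] := valP G.
rewrite andbT; apply/subsetP => y ye; rewrite !inE.
have [//|yX] := boolP (y \in X); rewrite /=.
apply/bigcupP; exists x => //; rewrite inE /adj.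
suff -> : [set x; y] = e by [].
apply/eqP; rewrite eqEcard (eqP e2) cards2.
have -> : x != y by apply: contraNneq yX => <-.
by rewrite andbT; apply/subsetP => z /set2P[] ->.
Qed.

Definition closed_subgraph (V : finType) (G : graph V) (X : {set V}) : graph V :=
  Graph (closed_subgraph_axiom G X).

Definition hiding_axiom (V : finType) (b : nat) (p : graph V * V) : bool :=
  connected_on p.1 [set: V] && (#|links p.1| <= b)%N.

Record hiding (V : finType) (b : nat) :=
  Hiding { hiding_val : graph V * V; _ : hiding_axiom b hiding_val }.

HB.instance Definition _ (V : finType) (b : nat) :=
  [isSub for @hiding_val V b].
HB.instance Definition _ (V : finType) (b : nat) :=
  [Finite of hiding V b by <:].

Definition hgraph (V : finType) (b : nat) (p : hiding V b) : graph V :=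
  (hiding_val p).1.
Definition hnode (V : finType) (b : nat) (p : hiding V b) : V :=
  (hiding_val p).2.

(* What the seeker may observe before a move: the sequence [i.1] of nodes visited
   so far, and the closed subgraph [i.2] that these nodes have revealed. *)
Definition info_axiom (V : finType) (s : V) (i : #|V|.-bseq V * graph V) : bool :=
  let z : seq V := i.1 in let G := i.2 in
  [&& (0 < size z < #|V|)%N,
      nth s z 0 == s,
      connected_on G (nodes G),
      [forall j : 'I_(size z),
         (0 < j)%N ==> (nth s z j \in nbrs G [set x in take j z])],
      G == closed_subgraph G [set x in z]
    & nbrs G [set x in z] != set0].

Record info (V : finType) (s : V) :=
  Info { info_val : #|V|.-bseq V * graph V; _ : info_axiom s info_val }.

HB.instance Definition _ (V : finType) (s : V) := [isSub for @info_val V s].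
HB.instance Definition _ (V : finType) (s : V) := [Finite of info s by <:].

Definition visited (V : finType) (s : V) (i : info s) : seq V :=
  (info_val i).1.
Definition igraph (V : finType) (s : V) (i : info s) : graph V :=
  (info_val i).2.
Definition frontier (V : finType) (s : V) (i : info s) : {set V} :=
  nbrs (igraph i) [set x in visited i].

Definition seeking_axiom (V : finType) (s : V) (r : {ffun info s -> V}) : bool :=
  [forall i, r i \in frontier i].

Record seeking (V : finType) (s : V) :=
  Seeking { seek_fun :> {ffun info s -> V}; _ : seeking_axiom seek_fun }.

HB.instance Definition _ (V : finType) (s : V) := [isSub for @seek_fun V s].
HB.instance Definition _ (V : finType) (s : V) := [Finite of seeking s by <:].

(* The default [s] is returned only when [(z, G)] is not an information state;
   this never happens along [seekseq] in a connected graph on [V]. *)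
Definition next_node (V : finType) (s : V) (r : seeking s) (z : seq V)
    (G : graph V) : V :=
  if insub (insub_bseq #|V| z, G) is Some i then r i else s.

(* The first [k.+1] entries of the seeking sequence. *)
Fixpoint seek_prefix (V : finType) (s : V) (G : graph V) (r : seeking s)
    (k : nat) : seq V :=
  if k is k'.+1 then
    let z := seek_prefix G r k' in
    rcons z (next_node r z (closed_subgraph G [set x in z]))
  else [:: s].

Definition seekseq (V : finType) (s : V) (G : graph V) (r : seeking s) : seq V :=
  seek_prefix G r #|V|.-1.

Definition pos (V : finType) (h : V) (v : seq V) : nat := index h v.

Record fdist (R : realFieldType) (T : finType) := FDist {
  fdist_fun :> {ffun T -> R};
  fdist_ge0 : forall x, 0 <= fdist_fun x;
  fdist_sum1 : \sum_x fdist_fun x = 1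
}.

Section Uniform.
Variables (R : realFieldType) (T : finType) (B : {set T}) (B0 : B != set0).

Let f : {ffun T -> R} := [ffun x => if x \in B then #|B|%:R^-1 else 0].

Let f_ge0 x : 0 <= f x.
Proof. by rewrite ffunE; case: ifP => // _; rewrite invr_ge0 ler0n. Qed.

Let f_sum1 : \sum_x f x = 1.
Proof.
under eq_bigr do rewrite ffunE.
rewrite -big_mkcond /= sumr_const -[X in X = _]mulr_natr mulVf //.
by rewrite pnatr_eq0 cards_eq0.
Qed.

Definition uniform : fdist R T := FDist f_ge0 f_sum1.

End Uniform.

Record behavior (R : realFieldType) (V : finType) (s : V) := Behavior {
  behavior_fun :> info s -> fdist R V;
  behavior_supp : forall i x, x \notin frontier i -> behavior_fun i x = 0
}.

(* The mixed strategy that draws the values of the pure strategy independently at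
   all information states, hence the product of probabilities. *)
Section MixedOfBehavior.
Variables (R : realFieldType) (V : finType) (s : V) (t : behavior R s).

Let f : {ffun seeking s -> R} := [ffun r : seeking s => \prod_i t i (r i)].

Let f_ge0 r : 0 <= f r.
Proof. by rewrite ffunE; apply: prodr_ge0 => i _; apply: fdist_ge0. Qed.

Let f_sum1 : \sum_r f r = 1.
Proof.
transitivity (\sum_(r : {ffun info s -> V}) \prod_i t i (r i)); last first.
  rewrite -(bigA_distr_bigA (fun i x => t i x)) /= big1 // => i _; exact: fdist_sum1.
rewrite (bigID (@seeking_axiom V s)) /= [X in _ = _ + X]big1 ?addr0; last first.
  move=> r; rewrite negb_forall => /existsP[i ri].
  by rewrite (bigD1 i) //= behavior_supp // mul0r.
rewrite (reindex_omap (val : seeking s -> _) insub) /=; last first.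
  by move=> r rP; rewrite insubT.
apply: eq_big => [r|r _]; last by rewrite ffunE.
by rewrite valK eqxx andbT (valP r).
Qed.

Definition mixed_of_behavior : fdist R (seeking s) := FDist f_ge0 f_sum1.

End MixedOfBehavior.

Section DFS.
Variables (V : finType) (s : V) (i : info s).

Let z := visited i.

Definition unvisited_nbrs (v : V) : {set V} :=
  nbr (igraph i) v :\: [set x in z].

Definition active_node : V :=
  nth s z (\max_(j < size z | unvisited_nbrs (nth s z j) != set0) j).

Lemma active_unvisited : unvisited_nbrs active_node != set0.
Proof.
have : frontier i != set0 by case/and5P: (valP i) => _ _ _ _ /andP[].
case/set0Pn => y; rewrite !inE => /andP[yz /bigcupP[x]]; rewrite inE => xz xy.
have xs : (index x z < size z)%N by rewrite index_mem.
have Px : unvisited_nbrs (nth s z (Ordinal xs)) != set0.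
  by rewrite /= nth_index //; apply/set0Pn; exists y; move: xy; rewrite !inE yz.
have [|j Pj jE] := @eq_bigmax_cond _
  [pred j : 'I_(size z) | unvisited_nbrs (nth s z j) != set0] (@nat_of_ord _).
  by apply/card_gt0P; exists (Ordinal xs).
by rewrite /active_node jE.
Qed.

Lemma unvisited_nbrs_frontier v :
  v \in z -> unvisited_nbrs v \subset frontier i.
Proof.
move=> vz; apply/subsetP => x; rewrite !inE => /andP[xz vx].
by rewrite xz /=; apply/bigcupP; exists v; rewrite inE.
Qed.

Lemma active_node_visited : active_node \in z.
Proof.
have /andP[z0 _] : (0 < size z < #|V|)%N by case/andP: (valP i).
apply: mem_nth; case: (size z) z0 => // k _.
by rewrite ltnS; apply/bigmax_leqP => j _; rewrite -ltnS.
Qed.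

End DFS.

Lemma dfs_supp (R : realFieldType) (V : finType) (s : V) (i : info s) (x : V) :
  x \notin frontier i -> uniform R (active_unvisited i) x = 0.
Proof.
move=> xi; rewrite ffunE ifN //; apply: contra xi.
exact/subsetP/unvisited_nbrs_frontier/active_node_visited.
Qed.

Definition randomized_dfs (R : realFieldType) (V : finType) (s : V) :
    fdist R (seeking s) :=
  mixed_of_behavior
    (Behavior (behavior_fun := fun i => uniform R (active_unvisited i))
              (@dfs_supp R V s)).

Section Payoffs.
Variables (R : realFieldType) (V : finType) (s : V) (b : nat) (A : nat -> R).

Definition benefit (p : hiding V b) : R := A (dist (hgraph p) s (hnode p)).

Definition pure_payoffS (p : hiding V b) (r : seeking s) : R :=
  - (pos (hnode p) (seekseq (hgraph p) r))%:R.

Definition pure_payoffH (p : hiding V b) (r : seeking s) : R :=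
  (pos (hnode p) (seekseq (hgraph p) r))%:R * benefit p.

Definition payoffS (eta : fdist R (hiding V b)) (sigma : fdist R (seeking s)) : R :=
  \sum_p \sum_r eta p * sigma r * pure_payoffS p r.

Definition payoffH (eta : fdist R (hiding V b)) (sigma : fdist R (seeking s)) : R :=
  \sum_p \sum_r eta p * sigma r * pure_payoffH p r.

Definition best_responseS (eta : fdist R (hiding V b))
    (sigma : fdist R (seeking s)) : Prop :=
  forall sigma', payoffS eta sigma' <= payoffS eta sigma.

Definition best_responseH (sigma : fdist R (seeking s))
    (eta : fdist R (hiding V b)) : Prop :=
  forall eta', payoffH eta' sigma <= payoffH eta sigma.

Definition nash (eta : fdist R (hiding V b)) (sigma : fdist R (seeking s)) : Prop :=
  best_responseH sigma eta /\ best_responseS eta sigma.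

End Payoffs.

Definition palm_links (V : finType) (s : V) (d : nat) (v : seq V) :
    {set {set V}} :=
  [set [set nth s v i; nth s v i.+1] | i : 'I_d.-1] :|:
  [set [set nth s v d.-1; nth s v j] | j : 'I_#|V| & (d <= j)%N].

(* [G] is a palm tree of height [d], as witnessed by the ordering [v] of [V]. *)
Definition palm_tree (V : finType) (s : V) (d : nat) (v : #|V|.-tuple V)
    (G : graph V) : Prop :=
  [/\ (0 < d < #|V|)%N, uniq v, nth s v 0 = s,
      nodes G = [set: V] & links G = palm_links s d v].

Definition crown (V : finType) (d : nat) (v : seq V) : {set V} :=
  [set x in drop d v].

(* The palm tree is fixed, and only the hiding node is random. *)
Definition crown_hiding (R : realFieldType) (V : finType) (s : V) (b d : nat)
    (eta : fdist R (hiding V b)) : Prop :=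
  exists (v : #|V|.-tuple V) (G : graph V), palm_tree s d v G /\
    forall p : hiding V b,
      eta p = if (hgraph p == G) && (hnode p \in crown d v)
              then #|crown d v|%:R^-1 else 0.

Definition Dscore (R : realFieldType) (n : nat) (A : nat -> R) (d : nat) : R :=
  A d * ((n%:R + d%:R - 1) / 2).

Definition Dstar (R : realFieldType) (n : nat) (A : nat -> R) : {set 'I_n} :=
  [set d : 'I_n | (0 < d)%N &&
     [forall e : 'I_n, (0 < e)%N ==> (Dscore n A e <= Dscore n A d)]].

(* Main.v *)
(* Against the randomized depth-first search, a node off the path from the source
   to the hiding node h, at depth k, is visited before h with probability at most
   1/2: if it is not below h, then the two branches to it and to h start at two
   siblings a and b, and exchanging a and b in every choice that offers both is a
   measure-preserving involution of the pure strategies which reverses the order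
   of visit of the two branches.  Hence the expected position of h is at most
   (n + k - 1) / 2.  In a palm tree of height d, every seeker finds the crown at
   positions d, ..., n - 1, of average (n + d - 1) / 2.  So the value of the game
   for the hider is the maximum of A d (n + d - 1) / 2. *)
Require Import Defs.
From mathcomp Require Import all_boot all_order all_algebra perm ring lra.

Set Implicit Arguments.
Unset Strict Implicit.
Unset Printing Implicit Defensive.

Import Order.TTheory GRing.Theory Num.Theory.
Local Open Scope ring_scope.

Lemma set2_eqP (T : finType) (a b c d : T) :
  [set a; b] = [set c; d] -> (a = c /\ b = d) \/ (a = d /\ b = c).
Proof.
move=> E.
have aE : a \in [set c; d] by rewrite -E set21.
have bE : b \in [set c; d] by rewrite -E set22.
have cE : c \in [set a; b] by rewrite E set21.
have dE : d \in [set a; b] by rewrite E set22.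
case/set2P: aE => ?; case/set2P: bE => ?; subst; [|by left|by right|].
- by left; case/set2P: dE.
- by left; case/set2P: cE.
Qed.

Lemma uniq_size_mem (T : finType) (z : seq T) (x : T) :
  uniq z -> size z = #|T| -> x \in z.
Proof.
move=> z_uniq zT; suff /eqP/setP/(_ x) : [set y in z] == setT by rewrite !inE.
by rewrite eqEcard subsetT cardsT cardsE (card_uniqP z_uniq) zT leqnn.
Qed.

(** * Graphs and rooted trees *)

Section Graphs.
Variables (V : finType) (G : graph V).
Implicit Types (u v w : V) (X : {set V}).

Lemma adj_sym : symmetric (adj G).
Proof. by move=> u v; rewrite /adj setUC. Qed.

Lemma adj_closed X u v :
  adj (closed_subgraph G X) u v = adj G u v && ((u \in X) || (v \in X)).
Proof.
rewrite /adj inE; congr andb; apply/set0Pn/orP => [[x]|].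
  by rewrite !inE => /andP[/orP[] /eqP-> ->]; [left|right].
by case=> ?; [exists u|exists v]; rewrite !inE eqxx ?orbT.
Qed.

Lemma nbr_closed X v : v \in X -> nbr (closed_subgraph G X) v = nbr G v.
Proof. by move=> vX; apply/setP => w; rewrite !inE adj_closed vX andbT. Qed.

Lemma mem_nbrs X v :
  reflect (v \notin X /\ exists2 w, w \in X & adj G w v) (v \in nbrs G X).
Proof.
rewrite !inE; apply: (iffP andP) => -[vX].
  by case/bigcupP => w wX; rewrite inE => wv; split=> //; exists w.
by case=> w wX wv; split=> //; apply/bigcupP; exists w; rewrite ?inE.
Qed.

Lemma nbrs_closed X : nbrs (closed_subgraph G X) X = nbrs G X.
Proof. by congr (_ :\: _); apply: eq_bigr => v; apply: nbr_closed. Qed.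

Lemma closed_subgraphK X :
  closed_subgraph (closed_subgraph G X) X = closed_subgraph G X.
Proof.
apply: val_inj; congr pair; first by rewrite nbrs_closed.
by apply/setP => e; rewrite !inE -andbA andbb.
Qed.

Lemma nbrs_neq0 X u v :
  connected_on G [set: V] -> u \in X -> v \notin X -> nbrs G X != set0.
Proof.
case/andP=> _ /forall_inP/(_ u (in_setT _))/forall_inP/(_ v (in_setT _)) uv uX.
apply: contraNneq => N0.
have clX : closed (adj G) (mem X).
  apply: intro_closed => [|x y xy xX]; first exact/sym_connect_sym/adj_sym.
  rewrite -topredE /=; apply/negPn/negP => yX.
  by have /mem_nbrs : y \notin nbrs G X; [rewrite N0 inE|case; split=> //; exists x].
by rewrite -(closed_connect clX uv).
Qed.

Lemma dist_le u (p : seq V) : path (adj G) u p -> (dist G u (last u p) <= size p)%N.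
Proof.
move=> up; have [p_ge|p_lt] := leqP #|V| (size p).
  apply: leq_trans p_ge; rewrite /dist.
  by elim/big_rec: _ => // i x _ /(leq_trans (geq_minr _ _)).
have Pp : [exists q : (Ordinal p_lt).-tuple V,
             path (adj G) u q && (last u q == last u p)].
  by apply/existsP; exists (in_tuple p); rewrite /= up eqxx.
rewrite /dist -minEnat -leEnat.
exact: (bigmin_le_cond _ (fun k : 'I_#|V| => nat_of_ord k) Pp).
Qed.

(** A path without repeated nodes has fewer than [#|V|] links, so the minimum is not the default
    value. *)
Lemma dist_attained u v : connect (adj G) u v ->
  exists2 p, path (adj G) u p & last u p = v /\ size p = dist G u v.
Proof.
case/connectP=> p0 /shortenP[p up p_uniq _] vE.
have p_lt : (size p < #|V|)%N.
  by rewrite -[X in (X <= _)%N]/(size (u :: p)) -(card_uniqP p_uniq) max_card.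
have : (dist G u v < #|V|)%N by rewrite vE (leq_ltn_trans (dist_le up)).
(* Property carried through the minimum: a value below [#|V|] is the length of a path from [u] to
   [v]. The default satisfies it vacuously. *)
rewrite /dist; elim/big_ind: _ => [|x y Kx Ky|i]; first by rewrite ltnn.
  by rewrite /minn; case: ifP.
by case/existsP=> q /andP[uq /eqP qv] _; exists q; rewrite ?size_tuple.
Qed.

End Graphs.

(* A tree rooted at [s], given by the parent and the depth of each node; the
   parent of [s] is a junk value. *)
Definition rooted (V : finType) (s : V) (G : graph V) (par : V -> V)
    (lv : V -> nat) : Prop :=
  [/\ lv s = 0%N, forall v, v != s -> lv v = (lv (par v)).+1
    & links G = [set [set v; par v] | v in [set~ s]]].

Section Rooted.
Variables (V : finType) (s : V) (G : graph V) (par : V -> V) (lv : V -> nat).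
Hypothesis G_rooted : rooted s G par lv.

Lemma lv_root : lv s = 0%N. Proof. by case: G_rooted. Qed.

Lemma lv_par v : v != s -> lv v = (lv (par v)).+1.
Proof. by case: G_rooted => _ + _; apply. Qed.

Lemma rooted_adjP u v :
  reflect (u != s /\ v = par u \/ v != s /\ u = par v) (adj G u v).
Proof.
case: G_rooted => _ _ GE; rewrite /adj GE.
apply: (iffP imsetP) => [[w]|[[us ->]|[vs ->]]].
- by rewrite !inE => ws /set2_eqP[[-> ->]|[-> ->]]; [left|right].
- by exists u; rewrite ?inE.
- by exists v; rewrite ?inE // setUC.
Qed.

Lemma adj_par v : v != s -> adj G (par v) v.
Proof. by move=> vs; apply/rooted_adjP; right. Qed.

Lemma card_rooted_links : (#|links G| <= #|V|.-1)%N.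
Proof. by case: G_rooted => _ _ ->; rewrite -(cardsC1 s) leq_imset_card. Qed.

Lemma root_path v : exists2 p, path (adj G) s p & last s p = v /\ size p = lv v.
Proof.
elim: {v}(lv v) {-2}v (erefl (lv v)) => [|k IH] v vk.
  have [->|vs] := eqVneq v s; first by exists [::]; rewrite ?lv_root.
  by move: vk; rewrite lv_par.
have vs : v != s by apply: contra_eq_neq vk => ->; rewrite lv_root.
have [|p sp [pv pk]] := IH (par v); first by apply: succn_inj; rewrite -lv_par.
exists (rcons p v); first by rewrite rcons_path sp pv adj_par.
by rewrite last_rcons size_rcons pk -lv_par.
Qed.

Lemma rooted_connected : nodes G = [set: V] -> connected_on G [set: V].
Proof.
move=> GV; rewrite /connected_on GV eqxx; apply/forall_inP => u _.
apply/forall_inP => v _.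
have sC w : connect (adj G) s w.
  by have [p sp [<- _]] := root_path w; apply/connectP; exists p.
by apply: connect_trans (sC v); rewrite (sym_connect_sym (adj_sym G)).
Qed.

(** Depth grows by at most one along a link, so a path from [s] to [v] has at least [lv v] links;
    the path through the parents has exactly that many. *)
Lemma rooted_dist v : dist G s v = lv v.
Proof.
have lv_path u p : path (adj G) u p -> (lv (last u p) <= lv u + size p)%N.
  elim: p u => [|w p IH] u /=; first by rewrite addn0.
  case/andP=> uw /IH/leq_trans; apply; rewrite addnS -addSn leq_add2r.
  case/rooted_adjP: uw => -[us ->]; last by rewrite lv_par.
  by rewrite (lv_par us) ltnW.
have [p sp [pv pk]] := root_path v.
apply/eqP; rewrite eqn_leq -{1}pk -{1}pv dist_le //=.
have [|q sq [qv <-]] := @dist_attained _ G s v; first by apply/connectP; exists p.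
by rewrite -qv (leq_trans (lv_path _ _ sq)) ?lv_root.
Qed.

Lemma lv_lt v : (lv v < #|V|)%N.
Proof.
have [p0 sp0 [pv pk]] := root_path v.
rewrite -rooted_dist -pv; case/shortenP: sp0 => p sp p_uniq _.
apply: leq_ltn_trans (dist_le sp) _.
by rewrite -[X in (X <= _)%N]/(size (s :: p)) -(card_uniqP p_uniq) max_card.
Qed.

End Rooted.

(** The parent of [v] is a neighbour one step nearer to [s]. The links to parents are pairwise
    distinct, hence [#|V|.-1] in number, and the bound on links leaves room for no other. *)
Lemma tree_rooted (V : finType) (s : V) (G : graph V) :
  connected_on G [set: V] -> (#|links G| <= #|V|.-1)%N ->
  exists par lv, rooted s G par lv.
Proof.
case/andP=> _ /forall_inP/(_ s (in_setT _))/forall_inP sC Gb.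
pose nearer v := [pick w | adj G w v && ((dist G s w).+1 == dist G s v)].
pose par v := odflt s (nearer v).
have parP v : v != s -> adj G (par v) v /\ dist G s v = (dist G s (par v)).+1.
  move=> vs; rewrite /par /nearer; case: pickP => [w /andP[wv /eqP]|no] //=.
  have [p] := dist_attained (sC v (in_setT _)).
  elim/last_ind: p => [|p x _]; first by move=> _ [/= sv]; rewrite sv eqxx in vs.
  rewrite rcons_path last_rcons size_rcons => /andP[sp xp] [xv pv]; subst x.
  (* If the node before [v] on a shortest path were not nearer by one, a shorter path to it would
     extend to a path to [v] that is too short. *)
  have := no (last s p); rewrite xp -pv eqSS eqn_leq dist_le //=.
  have [q sq [qv qs]] := dist_attained (sC (last s p) (in_setT _)).
  move=> /negbT; rewrite -ltnNge -qs => q_lt.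
  have : (dist G s v <= size (rcons q v))%N.
    rewrite -{1}(last_rcons s q v); apply: dist_le.
    by rewrite rcons_path sq qv.
  by rewrite size_rcons -pv ltnS leqNgt q_lt.
exists par, (dist G s); split=> [|v /parP[]//|].
  by apply/eqP; rewrite -leqn0; apply: (@dist_le _ G s [::]).
apply/eqP; rewrite eq_sym eqEcard; apply/andP; split.
  apply/subsetP => e /imsetP[v]; rewrite !inE => /parP[+ _] ->.
  by rewrite /adj setUC.
apply: leq_trans Gb _; rewrite card_in_imset ?cardsC1 // => u v.
rewrite !inE => /parP[_ du] /parP[_ dv] /set2_eqP[[]//|[uv vu]].
(* If [u] and [v] were parents of each other, [dist G s u] would exceed itself by two. *)
by move: du; rewrite vu dv -uv => /eqP; rewrite -addn2 -{1}[dist G s u]addn0 eqn_add2l.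
Qed.

(** * Seeking sequences *)

(** The condition on visited sequences, stated in the whole graph instead of its revealed part and
    without a bound on the length, so that complete seeking sequences qualify. *)
Definition explores (V : finType) (s : V) (G : graph V) (z : seq V) : Prop :=
  [/\ (0 < size z)%N, nth s z 0 = s
    & forall j, (0 < j < size z)%N -> nth s z j \in nbrs G [set x in take j z]].

Section Exploration.
Variables (V : finType) (s : V) (G : graph V).
Implicit Types (z : seq V) (x : V).

Lemma mem_take_nth (T : eqType) (x0 : T) (t : seq T) (i j : nat) :
  (i < j)%N -> (i < size t)%N -> nth x0 t i \in take j t.
Proof.
move=> ij it; rewrite -(nth_take x0 ij) mem_nth // size_take_min.
by rewrite leq_min ij it.
Qed.

Lemma explores_uniq z : explores s G z -> uniq z.
Proof.
case=> _ _ zP; apply/negPn/negP => /(uniqPn s)[i [j [ij jz ijE]]].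
have := zP j; rewrite (leq_trans _ ij) //= jz => /(_ isT)/mem_nbrs[].
by rewrite inE -ijE mem_take_nth // (ltn_trans ij).
Qed.

Lemma explores_size z : explores s G z -> (size z <= #|V|)%N.
Proof. by move/explores_uniq/card_uniqP <-; apply: max_card. Qed.

Lemma explores_seq1 : explores s G [:: s].
Proof. by split=> // -[|j]. Qed.

Lemma explores_rcons z x : explores s G z -> x \in nbrs G [set y in z] ->
  explores s G (rcons z x).
Proof.
case=> z0 z0s zP xN; split=> [||j]; rewrite ?size_rcons // ?nth_rcons ?z0 //.
rewrite ltnS => /andP[j0]; rewrite leq_eqVlt => /orP[/eqP->|jz].
  by rewrite ltnn eqxx -cats1 take_size_cat.
by rewrite jz -cats1 takel_cat ?zP ?j0 // ltnW.
Qed.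

Lemma explores_index z v : explores s G z -> v \in z -> v != s ->
  exists w, [/\ w \in z, adj G w v & (index w z < index v z)%N].
Proof.
move=> [z0 z0s zP] vz vs; have iz : (index v z < size z)%N by rewrite index_mem.
have i0 : (0 < index v z)%N.
  by rewrite lt0n; apply: contra_neq vs => i0; rewrite -(nth_index s vz) i0.
have := zP (index v z); rewrite i0 iz nth_index // => /(_ isT)/mem_nbrs[_ [w]].
rewrite inE => wz wv; exists w; split=> //; first exact: mem_take wz.
by rewrite in_take_leq // in wz; rewrite ltnW.
Qed.

Hypothesis G_conn : connected_on G [set: V].

(** Hence [next_node] never falls back on its default along a seeking sequence. The state [i] is the
    same for all [r], which allows two strategies to be compared after a common prefix. *)
Lemma explores_info z : explores s G z -> (size z < #|V|)%N ->
  exists i : info s, [/\ visited i = z,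
    igraph i = closed_subgraph G [set x in z]
    & forall r : seeking s, next_node r z (closed_subgraph G [set x in z]) = r i].
Proof.
move=> Ez zV; have [z0 z0s zP] := Ez; set Gz := closed_subgraph G _.
have vz : insub_bseq #|V| z = z :> seq V.
  by rewrite /insub_bseq insubdK // unfold_in explores_size.
have sz : s \in z by rewrite -z0s mem_nth.
have [x xz] : exists x, x \notin z.
  apply/existsP; rewrite -negb_forall; apply: contraL zV => /forallP zT.
  rewrite -leqNgt -(card_uniqP (explores_uniq Ez)) -cardsT subset_leq_card //.
  by apply/subsetP => x _; rewrite zT.
(* The revealed subgraph is connected: by induction on the time of visit, each visited node is
   joined to [s] through visited nodes, and the frontier is one link away from them. *)
have sG v : v \in nodes Gz -> connect (adj Gz) s v.
  have zC u : u \in z -> connect (adj Gz) s u.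
    elim: {u}(index u z) {-2}u (leqnn (index u z)) => [|k IH] u uk uz.
      by move: uk; rewrite leqn0 => /eqP uk; rewrite -(nth_index s uz) uk z0s.
    have [->//|us] := eqVneq u s.
    have [w [wz wu wi]] := explores_index Ez uz us.
    apply: connect_trans (connect1 (_ : adj Gz w u)).
      by apply: IH => //; rewrite -ltnS (leq_trans wi).
    by rewrite adj_closed wu !inE wz.
  rewrite !inE => /orP[/zC//|/andP[_ /bigcupP[w]]]; rewrite !inE => wz wv.
  apply: connect_trans (zC w wz) (connect1 _).
  by rewrite adj_closed wv inE wz.
have iP : info_axiom s (insub_bseq #|V| z, Gz).
  apply/and5P; rewrite /= vz z0 zV z0s eqxx; split=> //.
  - rewrite /connected_on eqxx; apply/forall_inP => u /sG su.
    apply/forall_inP => v /sG; apply: connect_trans.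
    by rewrite (sym_connect_sym (adj_sym Gz)).
  - apply/forallP => j; apply/implyP => j0.
    have /mem_nbrs[jz [w]] := zP j (introT andP (conj j0 (ltn_ord j))).
    rewrite inE => wz wj; apply/mem_nbrs; split=> //; exists w; rewrite ?inE //.
    by rewrite adj_closed wj inE (mem_take wz).
  - rewrite closed_subgraphK eqxx nbrs_closed.
    by apply: (nbrs_neq0 G_conn (u := s) (v := x)); rewrite inE.
by exists (Info iP); split=> // r; rewrite /next_node insubT.
Qed.

Lemma explores_prefix (r : seeking s) k : (k < #|V|)%N ->
  explores s G (seek_prefix G r k) /\ size (seek_prefix G r k) = k.+1.
Proof.
elim: k => [|k IH] kV; first by split; first exact: explores_seq1.
have [Ez zk] := IH (ltnW kV); rewrite /= size_rcons zk; split=> //.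
apply: explores_rcons => //.
have [|i [iz iG ->]] := explores_info Ez; first by rewrite zk.
by have /forallP/(_ i) := valP r; rewrite /frontier iz iG nbrs_closed.
Qed.

Lemma explores_seekseq (r : seeking s) :
  explores s G (seekseq G r) /\ size (seekseq G r) = #|V|.
Proof.
have V0 : (0 < #|V|)%N by apply/card_gt0P; exists s.
by have [] := @explores_prefix r #|V|.-1; rewrite ?prednK.
Qed.

Lemma mem_seekseq (r : seeking s) x : x \in seekseq G r.
Proof.
have [/explores_uniq Ez zV] := explores_seekseq r; exact: uniq_size_mem.
Qed.

Lemma take_prefix (r : seeking s) m k : (k <= m)%N -> (m < #|V|)%N ->
  take k.+1 (seek_prefix G r m) = seek_prefix G r k.
Proof.
elim: m => [|m IH]; first by rewrite leqn0 => /eqP->.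
rewrite leq_eqVlt => /orP[/eqP-> mV|km mV].
  by rewrite take_oversize // (proj2 (explores_prefix r mV)).
rewrite -(IH km (ltnW mV)) /= -cats1 takel_cat //.
by rewrite (proj2 (explores_prefix r (ltnW mV))).
Qed.

Lemma take_seekseq (r : seeking s) k : (k < #|V|)%N ->
  take k.+1 (seekseq G r) = seek_prefix G r k.
Proof.
have V0 : (0 < #|V|)%N by apply/card_gt0P; exists s.
by move=> kV; rewrite take_prefix ?prednK // -ltnS prednK.
Qed.

End Exploration.

Section RootedExploration.
Variables (V : finType) (s : V) (G : graph V) (par : V -> V) (lv : V -> nat).
Hypothesis G_rooted : rooted s G par lv.

(** Some neighbour of [v] is visited before it. Were that neighbour a child of [v], induction on the
    index would put its parent [v] before it, a contradiction. *)
Lemma explores_par z v : explores s G z -> v \in z -> v != s ->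
  par v \in z /\ (index (par v) z < index v z)%N.
Proof.
move=> Ez; elim: {v}(index v z) {-2}v (leqnn (index v z)) => [|k IH] v vk vz vs.
  by have [w [_ _ /leq_trans/(_ vk)]] := explores_index Ez vz vs.
have [w [wz + wv]] := explores_index Ez vz vs.
case/(rooted_adjP G_rooted) => [[ws vE]|[_ wE]]; last by rewrite -wE.
have wk : (index w z <= k)%N by rewrite -ltnS (leq_trans wv).
have [_] := IH w wk wz ws.
by rewrite -vE ltnNge ltnW.
Qed.

Lemma explores_lv z v : explores s G z -> v \in z -> (lv v <= index v z)%N.
Proof.
move=> Ez; move vk: (lv v) => k; elim: k v vk => [//|k IH] v vk vz.
have vs : v != s by apply: contra_eq_neq vk => ->; rewrite (lv_root G_rooted).
have [pz pv] := explores_par Ez vz vs.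
have pk : lv (par v) = k by apply: succn_inj; rewrite -(lv_par G_rooted).
exact: leq_ltn_trans (IH _ pk pz) pv.
Qed.

End RootedExploration.

Lemma index_rcons_lt (T : eqType) (z : seq T) (x a b : T) :
  (index a z < index b z)%N -> (index a (rcons z x) < index b (rcons z x))%N.
Proof.
move=> ab; have az : a \in z by rewrite -index_mem (leq_trans ab) // index_size.
rewrite -cats1 !index_cat az; case: ifP => // _.
by rewrite (leq_trans ab) // (leq_trans (index_size _ _)) // leq_addr.
Qed.

Lemma index_rcons_new (T : eqType) (z : seq T) (a b : T) :
  a != b -> a \notin z -> b \notin z ->
  (index a (rcons z a) < index b (rcons z a))%N.
Proof.
move=> ab /negbTE az /negbTE bz; rewrite -cats1 !index_cat az bz /= eqxx.
by rewrite (negbTE ab) addn0 addn1.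
Qed.

(** This turns a position into a sum of indicators, to be averaged node by node. *)
Lemma index_le_count (T : finType) (z : seq T) (h : T) : uniq z ->
  (index h z <= \sum_u (index u z < index h z))%N.
Proof.
move=> z_uniq; rewrite -[X in (X <= _)%N](size_takel (index_size h z)).
rewrite -(card_uniqP (take_uniq _ z_uniq)) -sum1_card big_mkcond /=.
by apply: leq_sum => u _; rewrite in_take_leq ?index_size //; case: (_ < _)%N.
Qed.

(** * Depth-first search *)

Section Ancestors.
Variables (V : finType) (s : V) (G : graph V) (par : V -> V) (lv : V -> nat).
Hypothesis G_rooted : rooted s G par lv.

(** [connect up v u] means that [u] is [v] or an ancestor of [v]. The guard discards the junk parent
    of the root. *)
Definition up : rel V := fun v w => (v != s) && (w == par v).

Lemma up_par v : v != s -> up v (par v).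
Proof. by move=> vs; rewrite /up vs eqxx. Qed.

Lemma lv_ind (P : V -> Prop) :
  P s -> (forall v, v != s -> P (par v) -> P v) -> forall v, P v.
Proof.
move=> Ps Pv v; move vk: (lv v) => k; elim: k v vk => [|k IH] v vk.
  by have [->//|/(lv_par G_rooted)] := eqVneq v s; rewrite vk.
have [->//|vs] := eqVneq v s; apply/Pv/IH => //.
by apply: succn_inj; rewrite -(lv_par G_rooted).
Qed.

Lemma connect_up_root v : connect up v s.
Proof.
elim/lv_ind: v => // v vs; apply: connect_trans.
exact/connect1/up_par.
Qed.

Lemma connect_up_par h u :
  connect up h u -> u = h \/ h != s /\ connect up (par h) u.
Proof.
case/connectP=> -[/= _ ->|w p /= /andP[/andP[hs /eqP->] pp] ->]; first by left.
by right; split=> //; apply/connectP; exists p.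
Qed.

Lemma card_ancestors h : (#|[set u | connect up h u]| <= (lv h).+1)%N.
Proof.
elim/lv_ind: h => [|h hs IH].
  rewrite (lv_root G_rooted) -(cards1 s); apply/subset_leq_card/subsetP => u.
  by rewrite !inE => /connect_up_par[->|[]]; rewrite ?eqxx.
rewrite (lv_par G_rooted hs).
apply: (@leq_trans #|h |: [set u | connect up (par h) u]|).
  apply/subset_leq_card/subsetP => u; rewrite !inE.
  by case/connect_up_par=> [->|[_ ->]]; rewrite ?eqxx ?orbT.
by rewrite cardsU1 -add1n leq_add ?leq_b1.
Qed.

Definition siblings (a b : V) : bool :=
  [&& a != b, a != s, b != s & par a == par b].

Lemma siblings_sym a b : siblings a b = siblings b a.
Proof.
by rewrite /siblings (eq_sym a) (eq_sym (par a)) [(a != s) && _]andbCA.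
Qed.

Lemma ancestor_cases h u :
  [\/ connect up h u, connect up u h
    | exists a b, [/\ siblings a b, connect up h a & connect up u b]].
Proof.
elim/lv_ind: u => [|u us [hu|uh|[a [b [ab ha ub]]]]].
- by constructor 1; apply: connect_up_root.
(* The parent of [u] is [h] or a proper ancestor of [h]. In the latter situation [a] is its child
   towards [h], and either [a] is [u] or the two are siblings. *)
- have [|[a ha /andP[as_ /eqP aE]]] : par u = h \/
      exists2 a, connect up h a & up a (par u).
    case/connectP: hu => p; elim/last_ind: p => [_ /= ->|p w _]; first by left.
    rewrite rcons_path last_rcons => /andP[hp pw ->]; right.
    by exists (last h p) => //; apply/connectP; exists p.
  + by move=> <-; constructor 2; apply/connect1/up_par.
  have [<-|au] := eqVneq a u; first by constructor 1.
  by constructor 3; exists a, u; split=> //; rewrite /siblings au as_ us aE eqxx.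
- by constructor 2; apply: connect_trans uh; apply/connect1/up_par.
- constructor 3; exists a, b; split=> //.
  by apply: connect_trans ub; apply/connect1/up_par.
Qed.

Lemma explores_anc z h a : explores s G z -> h \in z -> connect up h a ->
  a \in z /\ (index a z <= index h z)%N.
Proof.
move=> Ez hz /connectP[p]; elim: p h hz => [|w p IH] h hz /= => [_ ->//|].
case/andP=> /andP[hs /eqP->] pp aE.
have [wz wh] := explores_par G_rooted Ez hz hs.
by have [az aw] := IH _ wz pp aE; split=> //; apply: leq_trans aw (ltnW wh).
Qed.

End Ancestors.

Section DepthFirst.
Variables (V : finType) (s : V) (G : graph V) (par : V -> V) (lv : V -> nat).
Hypothesis G_conn : connected_on G [set: V].
Hypothesis G_rooted : rooted s G par lv.

Local Notation up := (up s par).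
Local Notation siblings := (siblings s par).

Definition dfs_set (i : info s) : {set V} := unvisited_nbrs i (active_node i).

Definition depth_first (r : seeking s) : Prop := forall i, r i \in dfs_set i.

Definition info_at (i : info s) (z : seq V) : Prop :=
  [/\ explores s G z, visited i = z & igraph i = closed_subgraph G [set x in z]].

(** Parents are visited before their children, so an unvisited neighbour of the active node can only
    be a child of it. *)
Lemma dfs_setP i z : info_at i z -> forall x,
  reflect [/\ x \notin z, x != s & active_node i = par x] (x \in dfs_set i).
Proof.
case=> Ez iz iG x; have az := active_node_visited i; rewrite iz in az.
rewrite /dfs_set /unvisited_nbrs !inE iz iG adj_closed !inE az andbT.
apply: (iffP andP) => [[xz]|[xz xs aE]]; last first.
  by split=> //; rewrite aE; apply: (adj_par G_rooted).
case/(rooted_adjP G_rooted)=> [[as_ xE]|[xs aE]]; last by [].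
by have [] := explores_par G_rooted Ez az as_; rewrite -xE (negbTE xz).
Qed.

(** While two siblings are both unvisited, the search offers both or neither. *)
Lemma dfs_set_sibling i z a b : info_at i z -> siblings a b ->
  a \notin z -> b \notin z -> a \in dfs_set i -> b \in dfs_set i.
Proof.
move=> iz /and4P[_ _ bs /eqP abE] az bz /(dfs_setP iz)[_ _ aE].
by apply/(dfs_setP iz); split=> //; rewrite aE.
Qed.

Lemma index_active_node i z v : info_at i z -> v \in z ->
  unvisited_nbrs i v != set0 -> (index v z <= index (active_node i) z)%N.
Proof.
case=> Ez iz iG vz v0; rewrite /active_node.
set m := \max_(j < _ | _) _.
have z0 : (0 < size z)%N by case: z vz {Ez iz iG m}.
have mz : (m < size z)%N.
  rewrite /m -iz in z0 *; case: (size _) z0 => // k _.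
  by rewrite ltnS; apply/bigmax_leqP => j _; rewrite -ltnS.
rewrite iz index_uniq ?(explores_uniq Ez) //.
have vi : (index v z < size (visited i))%N by rewrite iz index_mem.
apply: (@leq_bigmax_cond _ _ _ (Ordinal vi)).
by rewrite /= iz nth_index.
Qed.

(* A sibling [x] of [a] is only entered once the subtree of [a] is exhausted:
   otherwise some visited node of that subtree, more recent than [a] and hence
   than [par a], would still have an unvisited neighbour. *)
Lemma dfs_set_exhausts i z a x h : info_at i z -> x \in dfs_set i ->
  siblings a x -> a \in z -> connect up h a -> h \in z.
Proof.
move=> iz /(dfs_setP iz)[xz xs xE] /and4P[_ as_ _ /eqP axE] az ha.
have [Ez _ _] := iz; apply/negPn/negP => hz.
(* On the path from [h] up to [a], which starts unvisited and ends visited, [y] is the last node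
   before the first visited one. *)
have [y [ys yz pz pa]] :
    exists y, [/\ y != s, y \notin z, par y \in z & connect up (par y) a].
  case/connectP: ha => p; elim: p h hz => [|w p IH] h hz /=.
    by move=> _ aE; rewrite -aE az in hz.
  case/andP=> /andP[hs /eqP wE] wp aE; have [wz|wz] := boolP (w \in z).
    by exists h; rewrite -wE; split=> //; apply/connectP; exists p.
  exact: IH wz wp aE.
have : unvisited_nbrs i (par y) != set0.
  have [_ zE GE] := iz; apply/set0Pn; exists y.
  by rewrite /unvisited_nbrs !inE zE GE adj_closed !inE pz yz andbT (adj_par G_rooted).
move/(index_active_node iz pz); rewrite xE -axE leqNgt => /negP[].
have [_ pai] := explores_par G_rooted Ez az as_.
by apply: leq_trans pai _; have [] := explores_anc G_rooted Ez pz pa.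
Qed.

Lemma seekseq_step (r : seeking s) v : v != s ->
  exists2 i, info_at i (take (index v (seekseq G r)) (seekseq G r)) & v = r i.
Proof.
move=> vs; set z := seekseq G r; have [Ez zV] := explores_seekseq G_conn r.
have vz := mem_seekseq G_conn r v; rewrite -/z in Ez zV vz.
move kE: (index v z) => k; case: k kE => [|k] kE.
  by case: Ez => _ z0 _; case/eqP: vs; rewrite -(nth_index s vz) kE.
have kV : (k.+1 < #|V|)%N by rewrite -zV -kE index_mem.
have [Ek sk] := explores_prefix G_conn r (ltnW kV).
have [|i [iz iG ir]] := explores_info G_conn Ek; first by rewrite sk.
exists i; first by rewrite take_seekseq // ltnW.
rewrite -ir -(nth_index s vz) kE -(nth_take s (ltnSn k.+1)) take_seekseq //=.
by rewrite nth_rcons sk ltnn eqxx.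
Qed.

(** When [b] is chosen, [a] has been visited, so the subtree of [a] is already exhausted. *)
Lemma depth_first_order (r : seeking s) a b h : depth_first r ->
  siblings a b -> connect up h a ->
  (index a (seekseq G r) < index b (seekseq G r))%N ->
  (index h (seekseq G r) < index b (seekseq G r))%N.
Proof.
move=> rD ab ha a_b; have [_ _ bs _] := and4P ab.
have [i iz bE] := seekseq_step r bs.
have bD : b \in dfs_set i by rewrite bE.
have aT : a \in take (index b (seekseq G r)) (seekseq G r).
  by rewrite in_take_leq // index_size.
have := dfs_set_exhausts iz bD ab aT ha.
by rewrite in_take_leq // index_size.
Qed.

End DepthFirst.

(** * Exchanging two nodes in the choices of a pure strategy *)

Section Swap.
Variables (V : finType) (s a b : V).

(** Restricting the exchange to states where depth-first search may choose either node keeps the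
    values in the frontier and makes the exchange a permutation of each [dfs_set i]. *)
Definition swap_fun (r : {ffun info s -> V}) : {ffun info s -> V} :=
  [ffun i => if (a \in dfs_set i) && (b \in dfs_set i)
             then tperm a b (r i) else r i].

Lemma dfs_set_frontier (i : info s) : dfs_set i \subset frontier i.
Proof. exact/unvisited_nbrs_frontier/active_node_visited. Qed.

Lemma swap_axiom (r : seeking s) : seeking_axiom (swap_fun r).
Proof.
apply/forallP => i; rewrite ffunE; have /forallP/(_ i) ri := valP r.
case: ifP => // /andP[ai bi]; have /subsetP fi := dfs_set_frontier i.
by case: tpermP => // _; apply: fi.
Qed.

Definition swap (r : seeking s) : seeking s := Seeking (swap_axiom r).

Lemma swapE (r : seeking s) i : swap r i =
  if (a \in dfs_set i) && (b \in dfs_set i) then tperm a b (r i) else r i.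
Proof. by rewrite ffunE. Qed.

Lemma swapK : involutive swap.
Proof.
move=> r; apply: val_inj; apply/ffunP => i; rewrite !swapE.
by case: (_ && _); rewrite ?tpermK.
Qed.

Lemma randomized_dfsE (R : realFieldType) (r : seeking s) :
  randomized_dfs R s r =
  \prod_i (if r i \in dfs_set i then #|dfs_set i|%:R^-1 else 0).
Proof. by rewrite ffunE; apply: eq_bigr => i _; rewrite ffunE. Qed.

(** The factor at a state depends only on whether the chosen node lies in [dfs_set i], and the
    exchange preserves this. *)
Lemma randomized_dfs_swap (R : realFieldType) (r : seeking s) :
  randomized_dfs R s (swap r) = randomized_dfs R s r.
Proof.
rewrite !randomized_dfsE; apply: eq_bigr => i _; rewrite swapE.
case: (boolP (_ && _)) => // /andP[ai bi]; congr (if _ then _ else _).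
by case: tpermP => [->|->|_ _]; rewrite ?ai ?bi.
Qed.

End Swap.

Lemma randomized_dfs_neq0 (R : realFieldType) (V : finType) (s : V)
  (r : seeking s) : randomized_dfs R s r != 0 -> depth_first r.
Proof.
rewrite randomized_dfsE => /prodf_neq0 rN i.
by have := rN i isT; case: ifP; rewrite ?eqxx.
Qed.

(** * Expected position of a node under the randomized depth-first search *)

Section ExpectedPosition.
Variables (V : finType) (s : V) (G : graph V) (par : V -> V) (lv : V -> nat).
Hypothesis G_conn : connected_on G [set: V].
Hypothesis G_rooted : rooted s G par lv.

(** The runs of [r] and of [swap a b r] coincide until one of [a], [b] is visited. At that moment
    both are on offer, so the runs pick different ones, and later moves cannot alter the order. *)
Lemma swap_first (r : seeking s) a b : siblings s par a b -> depth_first r ->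
  (index a (seekseq G r) < index b (seekseq G r))%N ->
  (index b (seekseq G (swap a b r)) < index a (seekseq G (swap a b r)))%N.
Proof.
move=> ab rD; rewrite /seekseq; set r' := swap a b r.
have [a_b as_ bs_ _] := and4P ab; have b_a : b != a by rewrite eq_sym.
(* The invariant along prefixes: neither node met and equal runs, or the order settled oppositely in
   the two runs. In a complete run [a] has been met, which rules out the first alternative. *)
suff prefixP k : (k < #|V|)%N ->
  let z := seek_prefix G r k in let z' := seek_prefix G r' k in
  [\/ [/\ a \notin z, b \notin z & z' = z],
      (index a z < index b z)%N /\ (index b z' < index a z')%N
    | (index b z < index a z)%N /\ (index a z' < index b z')%N].
  have V0 : (#|V|.-1 < #|V|)%N by rewrite prednK //; apply/card_gt0P; exists s.
  case: (prefixP _ V0) => [[az]|[]|[/ltnW]] //; last by rewrite leqNgt => /negbTE->.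
  by move: (mem_seekseq G_conn r a); rewrite /seekseq (negbTE az).
elim: k => [|k IH] kV /=; first by constructor 1; rewrite !inE.
have [Ez sz] := explores_prefix G_conn r (ltnW kV).
case: (IH (ltnW kV)) => [[az bz z'E]|[lt1 lt2]|[lt1 lt2]]; last 2 first.
- by constructor 2; split; apply: index_rcons_lt.
- by constructor 3; split; apply: index_rcons_lt.
rewrite z'E; set z := seek_prefix G r k in Ez sz az bz *.
have [|i [iz iG ir]] := explores_info G_conn Ez; first by rewrite sz.
have iP : info_at G i z by [].
rewrite !ir swapE.
have [ra|ra] := eqVneq (r i) a.
  have ai : a \in dfs_set i by rewrite -ra.
  have bi := dfs_set_sibling G_rooted iP ab az bz ai.
  by rewrite ra ai bi tpermL; constructor 2; split; apply: index_rcons_new.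
have [rb|rb] := eqVneq (r i) b.
  have bi : b \in dfs_set i by rewrite -rb.
  have ba : siblings s par b a by rewrite siblings_sym.
  have ai := dfs_set_sibling G_rooted iP ba bz az bi.
  by rewrite rb ai bi tpermR; constructor 3; split; apply: index_rcons_new.
constructor 1; rewrite !mem_rcons !inE !negb_or az bz ![_ == r i]eq_sym ra rb.
by split=> //; case: ifP => // _; rewrite tpermD // eq_sym.
Qed.

Variable R : realFieldType.

Let prob_before (u h : V) : R := \sum_r randomized_dfs R s r *
  (index u (seekseq G r) < index h (seekseq G r))%N%:R.

Let sigma_ge0 r : 0 <= randomized_dfs R s r. Proof. exact: fdist_ge0. Qed.

Lemma prob_before_le1 u h : prob_before u h <= 1.
Proof.
rewrite -[leRHS](fdist_sum1 (randomized_dfs R s)); apply: ler_sum => r _.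
by apply: ler_piMr; rewrite // lern1 leq_b1.
Qed.

(** The involution carries the runs with [b] first to runs with [a] first of the same weight, and
    the two events are disjoint. *)
Lemma prob_before_sibling a b : siblings s par a b -> prob_before b a <= 2^-1.
Proof.
move=> ab.
have swap_le : prob_before b a <= prob_before a b.
  rewrite [leRHS](reindex_inj (inv_inj (@swapK V s b a))).
  apply: ler_sum => r _; rewrite randomized_dfs_swap.
  have [->|/randomized_dfs_neq0 rD] := eqVneq (randomized_dfs R s r) 0.
    by rewrite !mul0r.
  rewrite ler_wpM2l // ler_nat; case: (boolP (_ < _)%N) => //.
  by move/(swap_first (etrans (siblings_sym _ _ _ _) ab) rD) => ->.
have sum_le1 : prob_before b a + prob_before a b <= 1.
  rewrite -big_split /= -[leRHS](fdist_sum1 (randomized_dfs R s)).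
  apply: ler_sum => r _; rewrite -mulrDr; apply: ler_piMr => //.
  rewrite -natrD lern1; by case: ltngtP.
by rewrite -[_^-1]mul1r ler_pdivlMr // mulr_natr mulr2n (le_trans _ sum_le1) // lerD2l.
Qed.

(** A descendant of [h] never precedes it. Otherwise the branches to [h] and [u] start at siblings
    [a] and [b], and [u] can precede [h] only if [b] precedes [a]. *)
Lemma prob_before_nonancestor u h : ~~ connect (up s par) h u ->
  prob_before u h <= 2^-1.
Proof.
move=> hu; case: (ancestor_cases G_rooted h u) => [/idPn|uh|] //.
  rewrite [X in X <= _]big1 ?invr_ge0 // => r _.
  have [Ez _] := explores_seekseq G_conn r.
  have [_] := explores_anc G_rooted Ez (mem_seekseq G_conn r u) uh.
  by rewrite leqNgt => /negbTE->; rewrite mulr0.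
case=> a [b [ab ha ub]]; apply: le_trans (prob_before_sibling ab).
apply: ler_sum => r _.
have [->|/randomized_dfs_neq0 rD] := eqVneq (randomized_dfs R s r) 0.
  by rewrite !mul0r.
rewrite ler_wpM2l // ler_nat.
have [Ez _] := explores_seekseq G_conn r.
have [bz bu] := explores_anc G_rooted Ez (mem_seekseq G_conn r u) ub.
have [a_b _ _ _] := and4P ab.
(* If [a] comes first, then [h], below [a], precedes [b] and hence [u]. *)
case: (ltngtP (index b _) (index a _)) =>
  [_|/(depth_first_order G_conn G_rooted rD ab ha) hb|].
- exact: leq_b1.
- by rewrite ltnNge (leq_trans (ltnW hb)).
- move=> E; case/eqP: a_b.
  by rewrite -(nth_index a (mem_seekseq G_conn r a)) -E nth_index.
Qed.

(** Each node other than [h] contributes at most 1/2, and each proper ancestor of [h] a further 1/2;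
    there are [#|V|.-1] of the former and at most [lv h] of the latter. *)
Lemma expected_pos_le h :
  \sum_r randomized_dfs R s r * (index h (seekseq G r))%:R <=
    (#|V|%:R + (lv h)%:R - 1) / 2.
Proof.
pose anc := [set u | connect (up s par) h u].
have before_le u : prob_before u h <= ((u != h)%:R + (u \in anc :\ h)%:R) / 2.
  rewrite !inE; have [->|uh] := eqVneq u h; rewrite /=.
    by rewrite [leLHS]big1 ?addr0 ?mul0r // => r _; rewrite ltnn mulr0.
  case: (boolP (connect _ _ _)) => hu.
    by rewrite -natrD divff ?pnatr_eq0 // prob_before_le1.
  by rewrite addr0 mul1r prob_before_nonancestor.
apply: (@le_trans _ _ (\sum_u prob_before u h)).
  rewrite exchange_big /=; apply: ler_sum => r _.
  rewrite -mulr_sumr ler_wpM2l // -natr_sum ler_nat.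
  by apply: index_le_count; have [/explores_uniq] := explores_seekseq G_conn r.
apply: le_trans (ler_sum _ (fun u _ => before_le u)) _.
rewrite -mulr_suml ler_wpM2r ?invr_ge0 // big_split /= -!natr_sum.
have count (B : {set V}) : (\sum_u (u \in B) = #|B|)%N.
  by rewrite -sum1_card [RHS]big_mkcond; apply: eq_bigr => u _; case: (_ \in _).
have -> : (\sum_u (u != h) = #|V|.-1)%N.
  by rewrite -(cardsC1 h) -count; apply: eq_bigr => u _; rewrite !inE.
rewrite count addrAC lerD //.
  by rewrite -{2}[#|V|]prednK -?natr1 ?addrK //; apply/card_gt0P; exists h.
have := card_ancestors G_rooted h.
by rewrite ler_nat (cardsD1 h) inE connect0 add1n ltnS.
Qed.

End ExpectedPosition.

(** * Palm trees *)

(** The form matches the crown average: there [m] is [d] and [m + k] is [#|V|]. *)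
Lemma sum_iota (R : realFieldType) (m k : nat) :
  \sum_(j <- iota m k) j%:R = k%:R * (((m + k)%:R + m%:R - 1) / 2) :> R.
Proof.
elim: k => [|k IH]; first by rewrite big_nil mul0r.
by rewrite -addn1 iotaD big_cat IH /= big_seq1 !natrD; field.
Qed.

Section Palm.
Variables (V : finType) (s : V) (d : nat) (v : #|V|.-tuple V).
Hypotheses (dV : (0 < d < #|V|)%N) (v_uniq : uniq v) (v0 : nth s v 0 = s).

(** Along the trunk the depth is the index in the ordering; the crown, from index [d] on, is all at
    depth [d] and has the node of index [d.-1] as parent. *)
Definition palm_lv (x : V) : nat := minn (index x v) d.
Definition palm_par (x : V) : V := nth s v (palm_lv x).-1.

Lemma mem_order x : x \in v.
Proof. by rewrite uniq_size_mem // size_tuple. Qed.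

Lemma index_order_lt x : (index x v < #|V|)%N.
Proof. by rewrite -[X in (_ < X)%N](size_tuple v) index_mem mem_order. Qed.

Lemma index_nth_order j : (j < #|V|)%N -> index (nth s v j) v = j.
Proof. by move=> jV; rewrite index_uniq // size_tuple. Qed.

Lemma palm_lv_nth j : (j < #|V|)%N -> palm_lv (nth s v j) = minn j d.
Proof. by move=> jV; rewrite /palm_lv index_nth_order. Qed.

Lemma index_order_gt0 x : x != s -> (0 < index x v)%N.
Proof.
move=> xs; rewrite lt0n; apply: contra_neq xs => x0.
by rewrite -(nth_index s (mem_order x)) x0.
Qed.

Lemma palm_lv_root : palm_lv s = 0%N.
Proof.
by rewrite -v0 palm_lv_nth ?min0n //; case/andP: dV => _; apply: leq_ltn_trans.
Qed.

Lemma palm_lv_par x : x != s -> palm_lv x = (palm_lv (palm_par x)).+1.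
Proof.
have [d0 dlt] := andP dV; move/index_order_gt0 => x0.
have lv0 : (0 < palm_lv x)%N by rewrite leq_min x0.
have lvd : (palm_lv x <= d)%N by apply: geq_minr.
rewrite /palm_par palm_lv_nth; last first.
  by rewrite (leq_trans _ dlt) // ltnS (leq_trans (leq_pred _)).
by rewrite (minn_idPl _) ?prednK // (leq_trans (leq_pred _)).
Qed.

Lemma palm_links_par :
  palm_links s d v = [set [set x; palm_par x] | x in [set~ s]].
Proof.
have [d0 dlt] := andP dV.
have nthNs j : (0 < j)%N -> (j < #|V|)%N -> nth s v j != s.
  move=> j0 jV; rewrite -{2}v0 nth_uniq ?size_tuple // -?lt0n //.
  exact: ltn_trans jV.
apply/setP => e; apply/setUP/imsetP.
  case=> /imsetP[j].
    move=> _ ->; have jd : (j.+1 < d)%N by rewrite -ltn_predRL.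
    have jV : (j.+1 < #|V|)%N := ltn_trans jd dlt.
    exists (nth s v j.+1); first by rewrite !inE nthNs.
    by rewrite /palm_par palm_lv_nth // (minn_idPl _) 1?ltnW // setUC.
  rewrite inE => dj ->; exists (nth s v j).
    by rewrite !inE nthNs // (leq_trans d0).
  by rewrite /palm_par palm_lv_nth // (minn_idPr _) // setUC.
case=> x; rewrite !inE => /index_order_gt0 x0 ->; rewrite /palm_par /palm_lv.
(* Nodes of index at least [d] give the crown links, those of smaller index the trunk links. *)
have [xd|dx] := ltnP (index x v) d; last first.
  right; apply/imsetP; exists (Ordinal (index_order_lt x)); rewrite ?inE //=.
  by rewrite nth_index ?mem_order // setUC.
have jd : ((index x v).-1 < d.-1)%N by rewrite -ltnS !prednK.
left; apply/imsetP; exists (Ordinal jd) => //=.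
by rewrite prednK // nth_index ?mem_order // setUC.
Qed.

Lemma palm_rooted (G : graph V) :
  links G = palm_links s d v -> rooted s G palm_par palm_lv.
Proof.
move=> GE; split; first exact: palm_lv_root.
  exact: palm_lv_par.
by rewrite GE palm_links_par.
Qed.

Lemma palm_graph_axiom : graph_axiom ([set: V], palm_links s d v).
Proof.
apply/forall_inP => e /=; rewrite palm_links_par subsetT => /imsetP[x].
rewrite !inE => /palm_lv_par xE ->; rewrite cards2.
suff -> : x != palm_par x by [].
by apply: contra_eq_neq xE => /= <-; rewrite neq_ltn ltnSn.
Qed.

Lemma crown_lv h : h \in crown d v -> palm_lv h = d.
Proof.
rewrite inE => /(nthP s)[j]; rewrite size_drop size_tuple => jd <-.
by rewrite nth_drop palm_lv_nth ?(minn_idPr _) ?leq_addr // -ltn_subRL.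
Qed.

Lemma card_crown : #|crown d v| = (#|V| - d)%N.
Proof. by rewrite cardsE (card_uniqP (drop_uniq _ v_uniq)) size_drop size_tuple. Qed.

(* A seeker cannot reach the crown before step [d], so its [#|V| - d] nodes
   occupy exactly the positions [d, ..., #|V| - 1], in some order. *)
Lemma sum_crown_pos (R : realFieldType) (G : graph V) (r : seeking s) :
  nodes G = [set: V] -> links G = palm_links s d v ->
  \sum_(h in crown d v) (index h (seekseq G r))%:R =
  #|crown d v|%:R * ((#|V|%:R + d%:R - 1) / 2) :> R.
Proof.
move=> GV /palm_rooted GR; have G_conn := rooted_connected GR GV.
have [Ez zV] := explores_seekseq G_conn r; set z := seekseq G r in Ez zV *.
have zT x : x \in z := mem_seekseq G_conn r x.
have d_uniq := drop_uniq d v_uniq.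
have -> : #|V|%:R = (d + (#|V| - d))%:R :> R by rewrite subnKC // ltnW; case/andP: dV.
rewrite card_crown -sum_iota.
transitivity (\sum_(h <- drop d v) (index h z)%:R : R).
  by rewrite big_uniq //=; apply: eq_bigl => h; rewrite inE.
rewrite -(big_map (index^~ z) xpredT (fun j => j%:R : R)); apply: perm_big.
have m_uniq : uniq (map (index^~ z) (drop d v)).
  rewrite map_inj_uniq // => x y xy.
  by rewrite -(nth_index s (zT x)) xy nth_index.
apply: uniq_perm => //; first exact: iota_uniq.
have m_sub : {subset map (index^~ z) (drop d v) <= iota d (#|V| - d)}.
  move=> _ /mapP[h hd ->]; rewrite mem_iota subnKC ?(ltnW (proj2 (andP dV))) //.
  have hC : h \in crown d v by rewrite inE.
  by rewrite -zV index_mem zT andbT -{1}(crown_lv hC) (explores_lv GR Ez).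
have [] // := uniq_min_size m_uniq m_sub _.
by rewrite size_iota size_map size_drop size_tuple.
Qed.

End Palm.

(** * Equilibria *)

Lemma sumr_ge0_eq0 (R : realFieldType) (T : finType) (F : T -> R) :
  (forall i, 0 <= F i) -> \sum_i F i = 0 -> forall i, F i = 0.
Proof. by move=> F0 sF i; apply: (psumr_eq0P _ sF). Qed.

Section Game.
Variables (R : realFieldType) (V : finType) (s : V) (b : nat) (A : nat -> R).
Implicit Types (p : hiding V b) (eta : fdist R (hiding V b)).
Implicit Types (sigma : fdist R (seeking s)).

Definition expected_pos sigma p : R :=
  \sum_r sigma r * (index (hnode p) (seekseq (hgraph p) r))%:R.

Lemma payoffSE eta sigma :
  payoffS eta sigma = - \sum_p eta p * expected_pos sigma p.
Proof.
rewrite -sumrN; apply: eq_bigr => p _; rewrite mulr_sumr -sumrN.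
by apply: eq_bigr => r _; rewrite mulrN mulrA.
Qed.

Lemma payoffHE eta sigma : payoffH A eta sigma =
  \sum_p eta p * (benefit s A p * expected_pos sigma p).
Proof.
apply: eq_bigr => p _; rewrite !mulr_sumr; apply: eq_bigr => r _.
by rewrite /pure_payoffH; ring.
Qed.

Lemma best_responseH_pure eta sigma p : best_responseH A sigma eta ->
  benefit s A p * expected_pos sigma p <= payoffH A eta sigma.
Proof.
have p0 : [set p] != set0 by rewrite -cards_eq0 cards1.
move/(_ (uniform R p0)); rewrite [leLHS]payoffHE (bigD1 p) //= big1 => [|q qp].
  by rewrite ffunE set11 cards1 invr1 mul1r addr0.
by rewrite ffunE inE (negbTE qp) mul0r.
Qed.

(* Weighting the seeker's payoffs by the inverse benefits turns the hider's
   indifference over her support into an upper bound on her payoff: it is here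
   that a game that is not zero-sum behaves like one. *)
Lemma nash_value eta1 sigma1 sigma (M : R) :
    (forall p, 0 < benefit s A p) ->
    (forall p, benefit s A p * expected_pos sigma p <= M) ->
    M <= payoffH A eta1 sigma1 -> nash A eta1 sigma1 ->
  [/\ payoffH A eta1 sigma1 = M, payoffS eta1 sigma1 = payoffS eta1 sigma
    & forall p, eta1 p != 0 -> benefit s A p * expected_pos sigma p = M].
Proof.
move=> Phi0 sigmaM wM [BRH /(_ sigma)]; set w := payoffH A eta1 sigma1 in wM *.
rewrite !payoffSE lerN2 => BRS.
(* The expected inverse benefit, by which the seeker's payoffs are compared with [w] and [M]. *)
pose S := \sum_p eta1 p / benefit s A p.
have eta0 p : 0 <= eta1 p := fdist_ge0 eta1 p.
have sumw : \sum_p eta1 p * expected_pos sigma1 p = w * S.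
  (* No pure strategy earns more than [w] and their average is [w], so every one in the support
     earns exactly [w]. *)
  have gap p : 0 <= eta1 p * (w - benefit s A p * expected_pos sigma1 p).
    by rewrite mulr_ge0 // subr_ge0 best_responseH_pure.
  have gap0 : \sum_p eta1 p * (w - benefit s A p * expected_pos sigma1 p) = 0.
    under eq_bigr do rewrite mulrBr.
    by rewrite sumrB -payoffHE -mulr_suml fdist_sum1 mul1r subrr.
  rewrite mulr_sumr; apply: eq_bigr => p _.
  have /eqP := sumr_ge0_eq0 gap gap0 p.
  rewrite mulf_eq0 subr_eq0 => /orP[/eqP->|/eqP->]; first by rewrite !mul0r mulr0.
  by field; rewrite gt_eqF.
have le_M p : eta1 p * expected_pos sigma p <= M * (eta1 p / benefit s A p).
  rewrite mulrCA ler_wpM2l // ler_pdivlMr // mulrC; exact: sigmaM.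
have S0 : 0 < S.
  rewrite lt_def sumr_ge0 ?andbT => [|p _]; last by rewrite divr_ge0 // ltW.
  apply: contra_eq_neq (fdist_sum1 eta1) => S0.
  rewrite big1 1?eq_sym ?oner_neq0 // => p _.
  have /eqP := sumr_ge0_eq0 (fun p => divr_ge0 (eta0 p) (ltW (Phi0 p))) S0 p.
  by rewrite mulf_eq0 invr_eq0 (gt_eqF (Phi0 p)) orbF => /eqP.
have sumM : \sum_p eta1 p * expected_pos sigma p <= M * S.
  by rewrite mulr_sumr; apply: ler_sum.
(* As [sigma1] is a best response, [w * S] is at most the expected position under [sigma], hence at
   most [M * S]; cancel [S]. *)
have wE : w = M.
  by apply/eqP; rewrite eq_le wM andbT -(ler_pM2r S0) -sumw (le_trans BRS).
have sumE : \sum_p eta1 p * expected_pos sigma p = M * S.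
  by apply/eqP; rewrite eq_le sumM -wE -sumw BRS.
split=> //; first by rewrite sumw sumE wE.
move=> p etap.
(* Equality of the sums forces equality in each term of the bound [le_M]. *)
have gap0 : \sum_p (M * (eta1 p / benefit s A p) - eta1 p * expected_pos sigma p) = 0.
  by rewrite sumrB sumE -mulr_sumr subrr.
have /eqP := sumr_ge0_eq0 (fun p => etrans (subr_ge0 _ _) (le_M p)) gap0 p.
rewrite subr_eq0 mulrCA => /eqP/(mulfI etap) <-.
by field; rewrite gt_eqF.
Qed.

End Game.

(** * Payoffs of hiding in a crown *)

Section Crown.
Variables (R : realFieldType) (V : finType) (s : V) (A : nat -> R).
Variables (d : nat) (v : #|V|.-tuple V) (G : graph V).
Hypothesis G_palm : palm_tree s d v G.
Local Notation hiding := (hiding V #|V|.-1).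

Lemma palm_tree_rooted : rooted s G (palm_par s d v) (palm_lv d v).
Proof. by case: G_palm => dV v_uniq v0 _ GE; apply: palm_rooted. Qed.

Lemma palm_hiding_axiom h : hiding_axiom #|V|.-1 (G, h).
Proof.
case: G_palm => _ _ _ GV _; apply/andP; split.
  exact: rooted_connected palm_tree_rooted GV.
exact: card_rooted_links palm_tree_rooted.
Qed.

Definition palm_hiding h : hiding := Hiding (palm_hiding_axiom h).

Lemma crown_gt0 : 0 < #|crown d v|%:R :> R.
Proof. by case: G_palm => /andP[_ dV] v_uniq *; rewrite card_crown // ltr0n subn_gt0. Qed.

(** The weights are written out instead of [eta] so that the formula also serves to construct such a
    distribution. *)
Lemma sum_crown_hiding (F : hiding -> R) :
  \sum_p (if (hgraph p == G) && (hnode p \in crown d v)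
          then #|crown d v|%:R^-1 else 0) * F p =
  #|crown d v|%:R^-1 * \sum_(h in crown d v) F (palm_hiding h).
Proof.
rewrite mulr_sumr.
rewrite (bigID (fun p : hiding => (hgraph p == G) && (hnode p \in crown d v))) /=.
rewrite [X in _ + X]big1 => [|p /negbTE->]; last by rewrite mul0r.
rewrite addr0 (reindex_onto palm_hiding (@hnode V _)) => [|p /andP[/eqP pG _]].
  apply: eq_big => [h|h]; first by rewrite /hgraph /hnode /= !eqxx andbT.
  by move=> /andP[-> _].
by apply: val_inj; rewrite /= -pG; case: p {pG} => -[].
Qed.

Variable eta : fdist R hiding.
Hypothesis etaE : forall p, eta p =
  if (hgraph p == G) && (hnode p \in crown d v) then #|crown d v|%:R^-1 else 0.

(** The average over the crown is the same against every pure seeking strategy, so mixing does not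
    change it. *)
Lemma crown_expected_pos (sigma : fdist R (seeking s)) :
  \sum_p eta p * expected_pos sigma p = (#|V|%:R + d%:R - 1) / 2.
Proof.
under eq_bigr do rewrite etaE.
rewrite sum_crown_hiding exchange_big /=.
under eq_bigr => r _.
  rewrite -mulr_sumr; case: (G_palm) => dV v_uniq v0 GV GE.
  rewrite sum_crown_pos //; over.
by rewrite -mulr_suml fdist_sum1 mul1r mulKf // gt_eqF ?crown_gt0.
Qed.

Lemma crown_payoffS (sigma : fdist R (seeking s)) :
  payoffS eta sigma = - ((#|V|%:R + d%:R - 1) / 2).
Proof. by rewrite payoffSE crown_expected_pos. Qed.

Lemma crown_payoffH (sigma : fdist R (seeking s)) :
  payoffH A eta sigma = Dscore #|V| A d.
Proof.
rewrite payoffHE /Dscore -(crown_expected_pos sigma) mulr_sumr.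
apply: eq_bigr => p _; rewrite [RHS]mulrCA.
have := etaE p; case: ifP => [/andP[/eqP pG pC] _|_ ->]; last by rewrite !mul0r.
by rewrite /benefit pG (rooted_dist palm_tree_rooted) (crown_lv _ _ pC) //; case: G_palm.
Qed.

End Crown.

(** This provides an equilibrium for every optimal height; any ordering of the nodes that starts
    with [s] will do. *)
Lemma crown_hiding_exists (R : realFieldType) (V : finType) (s : V) (d : nat) :
  (0 < d < #|V|)%N ->
  exists eta : fdist R (hiding V #|V|.-1), crown_hiding s d eta.
Proof.
move=> dV; have szs : size (s :: enum [set~ s]) == #|V|.
  by rewrite /= -cardE cardsC1 prednK //; apply/card_gt0P; exists s.
pose v := Tuple szs.
have v_uniq : uniq v by rewrite /= enum_uniq mem_enum !inE eqxx.
pose G := Graph (palm_graph_axiom dV v_uniq (erefl s)).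
have GP : palm_tree s d v G by [].
pose f := [ffun p : hiding V #|V|.-1 =>
  if (hgraph p == G) && (hnode p \in crown d v) then #|crown d v|%:R^-1 else 0 : R].
have f0 p : 0 <= f p by rewrite ffunE; case: ifP => // _; rewrite invr_ge0.
have f1 : \sum_p f p = 1.
  under eq_bigr do rewrite ffunE -[if _ then _ else _]mulr1.
  rewrite (sum_crown_hiding GP (fun=> 1)) sumr_const mulVf //.
  by rewrite gt_eqF // (crown_gt0 R GP).
by exists (FDist f0 f1), v, G; split=> // p; rewrite ffunE.
Qed.

(** * What the randomized depth-first search concedes to the hider *)

Section RandomizedDFS.
Variables (R : realFieldType) (V : finType) (s : V) (A : nat -> R).
Hypothesis V_ge2 : (2 <= #|V|)%N.
Hypothesis A_gt0 : forall i : nat, (i < #|V|)%N -> 0 < A i.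
Local Notation hiding := (hiding V #|V|.-1).
Local Notation sigma := (randomized_dfs R s).

Lemma hiding_rooted (p : hiding) :
  connected_on (hgraph p) [set: V] /\ exists par lv, rooted s (hgraph p) par lv.
Proof.
have /andP[conn card] := valP p; split=> //.
exact: tree_rooted.
Qed.

Lemma benefit_gt0 (p : hiding) : 0 < benefit s A p.
Proof.
have [_ [par [lv GR]]] := hiding_rooted p.
by rewrite /benefit (rooted_dist GR) A_gt0 // (lv_lt GR).
Qed.

Variable d : 'I_#|V|.
Hypothesis d_opt : d \in Dstar #|V| A.

Lemma Dstar_gt0 : (0 < d)%N. Proof. by case/setIdP: d_opt. Qed.

Lemma Dscore_max e : (0 < e < #|V|)%N -> Dscore #|V| A e <= Dscore #|V| A d.
Proof.
case/andP=> e0 eV; move: d_opt; rewrite inE.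
by case/andP=> _ /forall_inP/(_ (Ordinal eV) e0).
Qed.

Lemma Dscore_gt0 : 0 < Dscore #|V| A d.
Proof.
rewrite mulr_gt0 ?A_gt0 // divr_gt0 // -addrA.
have d1 : 1 <= d%:R :> R by rewrite ler1n Dstar_gt0.
have V2 : 2 <= #|V|%:R :> R by rewrite ler_nat.
by lra.
Qed.

(** With [k] the distance of the hiding node, the payoff is at most [Dscore #|V| A k], hence at most
    the maximum. Equality makes both bounds tight: [k] is optimal and the expected position attains
    its bound. *)
Lemma dfs_payoff_le (p : hiding) :
  benefit s A p * expected_pos sigma p <= Dscore #|V| A d /\
  (benefit s A p * expected_pos sigma p = Dscore #|V| A d ->
   exists2 e : 'I_#|V|, e \in Dstar #|V| A &
     expected_pos sigma p = (#|V|%:R + e%:R - 1) / 2).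
Proof.
have [conn [par [lv GR]]] := hiding_rooted p.
have b0 := benefit_gt0 p; have M0 := Dscore_gt0.
have := expected_pos_le conn GR R (hnode p); rewrite -/(expected_pos sigma p).
move: b0; rewrite /benefit (rooted_dist GR) => b0.
have lvV := lv_lt GR (hnode p).
(* Depth 0 is not among the heights over which the score is maximal; hiding at the source earns 0,
   below the positive maximum. *)
have [hs|hs] := eqVneq (hnode p) s.
  have -> : expected_pos sigma p = 0.
    apply: big1 => r _.
    suff -> : index (hnode p) (seekseq (hgraph p) r) = 0%N by rewrite mulr0.
    have [[z0 zs _] _] := explores_seekseq conn r.
    by rewrite hs; case: (seekseq _ _) z0 zs => //= x z _ ->; rewrite eqxx.
  by rewrite mulr0 => _; split=> [|M_0]; [apply: ltW|move: M0; rewrite -M_0 ltxx].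
have e0 : (0 < lv (hnode p))%N by rewrite (lv_par GR).
move=> pos_le; have le1 := ler_wpM2l (ltW b0) pos_le.
have le2 := Dscore_max (introT andP (conj e0 lvV)).
split=> [|E]; first exact: le_trans le1 le2.
have scoreE : Dscore #|V| A (lv (hnode p)) = Dscore #|V| A d.
  by apply/eqP; rewrite eq_le le2 -E.
exists (Ordinal lvV) => /=; last first.
  by apply: (mulfI (lt0r_neq0 b0)); rewrite E -scoreE.
rewrite inE e0; apply/forall_inP => e; rewrite scoreE => ?.
by apply: Dscore_max; apply/andP; split.
Qed.

(** The hider already earns the most that [sigma] concedes, and the seeker's payoff against [eta]
    does not depend on the seeking strategy. *)
Lemma crown_nash (eta : fdist R hiding) : crown_hiding s d eta -> nash A eta sigma.
Proof.
move=> [v [G [GP etaE]]]; split=> [eta'|sigma'].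
  rewrite [leRHS](crown_payoffH A GP) // payoffHE.
  rewrite -[leRHS]mul1r -(fdist_sum1 eta') mulr_suml.
  by apply: ler_sum => p _; rewrite ler_wpM2l ?fdist_ge0 //; case: (dfs_payoff_le p).
by rewrite !(crown_payoffS GP).
Qed.

End RandomizedDFS.

Theorem theorem1 (R : realFieldType) (V : finType) (s : V) (A : nat -> R)
  (V_ge2 : (2 <= #|V|)%N)
  (A_gt0 : forall i : nat, (i < #|V|)%N -> 0 < A i)
  (A_noninc : forall i j : nat, (i <= j)%N -> (j < #|V|)%N -> A j <= A i)
  (d : 'I_#|V|) (d_opt : d \in Dstar #|V| A)
  (eta : fdist R (hiding V #|V|.-1))
  (eta_crown : crown_hiding s d eta) :
  let sigma := randomized_dfs R s in
  [/\ nash A eta sigma,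
      (forall (eta1 eta2 : fdist R (hiding V #|V|.-1))
              (sigma1 sigma2 : fdist R (seeking s)),
         nash A eta1 sigma1 -> nash A eta2 sigma2 ->
         payoffH A eta1 sigma1 = payoffH A eta2 sigma2) /\
      (forall (eta1 : fdist R (hiding V #|V|.-1))
              (sigma1 sigma' : fdist R (seeking s)),
         nash A eta1 sigma1 ->
         payoffH A eta1 sigma1 <= payoffH A eta sigma'),
      (forall (eta' : fdist R (hiding V #|V|.-1))
              (sigma' : fdist R (seeking s)),
         nash A eta' sigma' -> best_responseS eta' sigma)
    & (forall (eta1 eta2 : fdist R (hiding V #|V|.-1))
              (sigma1 sigma2 : fdist R (seeking s)),
         nash A eta1 sigma1 -> nash A eta2 sigma2 ->
         payoffS eta1 sigma1 = payoffS eta2 sigma2)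
      <-> #|Dstar #|V| A| = 1%N].
Proof.
move=> sigma; have [v [G [GP etaE]]] := eta_crown.
have value (eta1 : fdist R (hiding V #|V|.-1)) (sigma1 : fdist R (seeking s))
    : nash A eta1 sigma1 ->
    [/\ payoffH A eta1 sigma1 = Dscore #|V| A d,
        payoffS eta1 sigma1 = payoffS eta1 sigma
      & forall p, eta1 p != 0 ->
          benefit s A p * expected_pos sigma p = Dscore #|V| A d].
  move=> N; apply: nash_value => //.
  - exact: benefit_gt0.
  - by move=> p; case: (dfs_payoff_le s V_ge2 A_gt0 d_opt p).
  (* In equilibrium the hider earns at least what deviating to [eta] would guarantee. *)
  - by rewrite -(crown_payoffH A GP etaE sigma1); case: N.
split.
- exact: crown_nash d_opt _ eta_crown.
- split=> [eta1 eta2 sigma1 sigma2 /value[-> _ _] /value[-> _ _] //|].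
  by move=> eta1 sigma1 sigma' /value[-> _ _]; rewrite (crown_payoffH A GP).
- by move=> eta' sigma' N sigma''; have [_ <- _] := value _ _ N; case: N.
split=> [uniqS|/eqP/cards1P[e0 DE]].
  (* Two optimal heights give two crown equilibria, and the seeker's payoffs in them agree only if
     the heights do. *)
  apply/eqP/cards1P; exists d; apply/setP => e; rewrite inE.
  apply/idP/eqP => [e_opt|-> //].
  have [|eta_e eta_e_crown] := @crown_hiding_exists R V s e.
    by rewrite (Dstar_gt0 e_opt) ltn_ord.
  have := uniqS _ _ _ _ (crown_nash V_ge2 A_gt0 d_opt eta_crown)
                        (crown_nash V_ge2 A_gt0 e_opt eta_e_crown).
  have [v' [G' [GP' eta_eE]]] := eta_e_crown.
  rewrite (crown_payoffS GP etaE) (crown_payoffS GP' eta_eE) => E.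
  apply/val_inj/eqP; rewrite /= -(eqr_nat R); apply/eqP; lra.
(* The seeker's payoff may be computed against [sigma], under which every hiding strategy in the
   support has the expected position belonging to the only optimal height [e0]. *)
suff payoffE (eta1 : fdist R (hiding V #|V|.-1)) (sigma1 : fdist R (seeking s))
    : nash A eta1 sigma1 ->
    payoffS eta1 sigma1 = - ((#|V|%:R + e0%:R - 1) / 2).
  by move=> eta1 eta2 sigma1 sigma2 /payoffE-> /payoffE->.
case/value=> _ -> eta1E; rewrite payoffSE; congr (- _).
rewrite -[RHS]mul1r -[X in _ = X * _](fdist_sum1 eta1) mulr_suml.
apply: eq_bigr => p _.
have [->|etap] := eqVneq (eta1 p) 0; first by rewrite !mul0r.
have [_ /(_ (eta1E p etap))[e]] := dfs_payoff_le s V_ge2 A_gt0 d_opt p.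
by rewrite DE inE => /eqP-> ->.
Qed.
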